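(* Let $\Omega\subset\mathbb{R}^2$ be a smooth, convex, bounded domain with boundary $\Gamma$, and let $f\in C^\infty(\overline{\Omega})$ with $f>0$. Assume that the Dirichlet problem $$\det[D^2u]=f \ \text{ in } \Omega,\qquad u|_{\Gamma}=0,\qquad u \text{ convex},\qquad (\mathrm{MA})$$ has a unique strictly convex solution in $C^\infty(\overline{\Omega})$. Let $$E=\{\varphi\in C^\infty(\overline{\Omega}) : \varphi\ge 0\}.$$ For $g\in E$ let $u^g$ denote the solution of the Dirichlet problem $\Delta u=2\sqrt{f}+g$ in $\Omega$, $u|_{\Gamma}=0$, and put $$J(g)=\frac12\int_\Omega\left(\det(D^2u^g)-f\right)^2dx .$$ Let $u_I\in C^\infty(\overline{\Omega})$. Then $u_I$ is the strictly convex solution of $(\mathrm{MA})$ if and only if there exists a unique solution $\widetilde g$ of the minimization problem $$\widetilde g\in E,\qquad J(\widetilde g)\le J(g)\quad\text{for all } g\in E,$$ such that $u_I=u^{\widetilde g}$.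
   Context: $D^2u$ denotes the Hessian matrix of $u$, and $\Delta u$ its trace (the Laplacian). For each $g\in E$ the Poisson problem $\Delta u=2\sqrt f+g$ in $\Omega$, $u=0$ on $\Gamma$, has a unique solution, denoted $u^g$. The existence and uniqueness of a strictly convex solution of $(\mathrm{MA})$ in $C^\infty(\overline{\Omega})$ is a fact the paper takes from the literature and uses as a standing assumption. *)

(* Defs.v *)
From HB Require Import structures.
From mathcomp Require Import all_boot all_order all_algebra.
From mathcomp Require Import all_classical all_reals all_analysis.

Set Implicit Arguments.
Unset Strict Implicit.
Unset Printing Implicit Defensive.

Import Order.TTheory GRing.Theory Num.Theory.
Import numFieldNormedType.Exports.

Local Open Scope classical_set_scope.
Local Open Scope ring_scope.

(* The plane is R * R. A function on the closure of a domain is represented by a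
   total function on R * R whose values outside that closure are irrelevant, so
   equality of such functions is pointwise equality on the closure. *)

Definition basis2 (R : realType) (i : 'I_2) : R * R :=
  if i == ord0 then (1, 0) else (0, 1).

Definition partial (R : realType) (i : 'I_2) (u : R * R -> R) : R * R -> R :=
  fun x => 'D_(basis2 R i) u x.

Definition partials (R : realType) (s : seq 'I_2) (u : R * R -> R) :
    R * R -> R :=
  foldr (@partial R) u s.

Definition hessian (R : realType) (u : R * R -> R) (x : R * R) : 'M[R]_2 :=
  \matrix_(i, j) partial i (partial j u) x.

Definition laplacian (R : realType) (u : R * R -> R) (x : R * R) : R :=
  \tr (hessian u x).

(* Derivability of the iterated partials has to be required separately, since
   'D_v f x is total. *)
Definition smooth_on (R : realType) (A : set (R * R)) (u : R * R -> R) : Prop :=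
  forall (s : seq 'I_2) (x : R * R), A x ->
    {for x, continuous (partials s u)} /\
    forall i : 'I_2, derivable (partials s u) x (basis2 R i).

(* C^oo of the closure of an open set O: smooth in O, and the function and all
   its derivatives extend continuously to the closure. *)
Definition smooth_closure (R : realType) (O : set (R * R)) (u : R * R -> R) :
    Prop :=
  [/\ smooth_on O u,
      {within closure O, continuous u} &
      forall s : seq 'I_2, exists v : R * R -> R,
        {within closure O, continuous v} /\
        forall x, O x -> v x = partials s u x].

Definition boundary (T : topologicalType) (A : set T) : set T :=
  closure A `\` interior A.

(* Near each boundary point, O is the sublevel set {rho < 0} of a smooth function
   rho whose gradient does not vanish at that point. *)
Definition smooth_boundary (R : realType) (O : set (R * R)) : Prop :=
  forall p, boundary O p ->
    exists (U : set (R * R)) (rho : R * R -> R),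
      [/\ open U, U p, smooth_on U rho,
          exists i : 'I_2, partial i rho p != 0 &
          O `&` U = [set x | rho x < 0] `&` U].

(* Connectedness is implied by convexity. *)
Definition smooth_convex_bounded_domain (R : realType) (O : set (R * R)) :
    Prop :=
  [/\ O !=set0, open O, convex_set O, bounded_set O & smooth_boundary O].

Definition strictly_convex_function (R : realType) (O : set (R * R))
    (u : R * R -> R) : Prop :=
  forall (x y : R * R) (t : R), O x -> O y -> x != y -> 0 < t -> t < 1 ->
    u (t *: x + (1 - t) *: y) < t * u x + (1 - t) * u y.

Definition MA_solution (R : realType) (O : set (R * R)) (f u : R * R -> R) :
    Prop :=
  [/\ forall x, O x -> \det (hessian u x) = f x,
      forall x, boundary O x -> u x = 0 &
      convex_function O u].

Definition strictly_convex_MA_solution (R : realType) (O : set (R * R))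
    (f u : R * R -> R) : Prop :=
  [/\ smooth_closure O u, MA_solution O f u & strictly_convex_function O u].

Definition E_set (R : realType) (O : set (R * R)) : set (R * R -> R) :=
  [set g | smooth_closure O g /\ forall x, closure O x -> 0 <= g x].

Definition poisson_solution (R : realType) (O : set (R * R))
    (f g u : R * R -> R) : Prop :=
  [/\ smooth_closure O u,
      forall x, O x -> laplacian u x = 2 * Num.sqrt (f x) + g x &
      forall x, boundary O x -> u x = 0].

(* The function u^g. The default value, the zero function, is only used when the
   Poisson problem has no solution, which elliptic theory excludes on a smooth
   bounded domain for g in E and f smooth and positive on the closure. *)
Definition poisson_sol (R : realType) (O : set (R * R)) (f g : R * R -> R) :
    R * R -> R :=
  xget (fun=> 0) [set u | poisson_solution O f g u].

(* The integral is the extended-real one; the integrand is nonnegative, so no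
   integrability convention is involved. *)
Definition J (R : realType) (O : set (R * R)) (f g : R * R -> R) : \bar R :=
  ((2^-1)%:E *
   \int[@lebesgue_measure R \x @lebesgue_measure R]_(x in O)
     (((\det (hessian (poisson_sol O f g) x) - f x) ^+ 2)%:E))%E.

Definition J_minimizer (R : realType) (O : set (R * R)) (f g : R * R -> R) :
    Prop :=
  E_set O g /\ forall h, E_set O h -> (J O f g <= J O f h)%E.

(* Main.v *)
Require Import Defs.
From HB Require Import structures.
From mathcomp Require Import all_boot all_order all_algebra.
From mathcomp Require Import all_classical all_reals all_analysis.
From mathcomp Require Import ring lra.

(** The functional J is nonnegative and, under the standing assumption, its
    minimum over E is 0; its zeros are the sources g = Delta u - 2 sqrt f of the
    strictly convex solutions u of the Monge-Ampere problem.

    From a solution to a zero of J.  At a point of the domain let a, b, d be the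
    entries of the symmetric Hessian of a strictly convex solution u.  Convexity
    gives a, d >= 0, and then (a + d)^2 >= 4 a d >= 4 (a d - b^2) = 4 f, so that
    g = Delta u - 2 sqrt f is nonnegative ([convex_laplacian_ge]).  It is smooth up to
    the boundary because f is positive there ([Ck_closure_rsqrt],
    [MA_poisson_source]).  By uniqueness for the Poisson problem
    ([poisson_solution_unique], a consequence of the maximum principle) u is
    u^g, hence J(g) = 0 ([J_eq0_poisson_source]).

    From a zero of J to a solution.  If J(g) = 0 then the continuous function
    det D^2 u^g - f vanishes everywhere in the domain ([J_eq0_pointwise]).  So
    det D^2 u^g = f > 0, while Delta u^g = 2 sqrt f + g > 0: the Hessian is
    positive definite and u^g is strictly convex ([posdef_strictly_convex],
    [J_eq0_MA_solution]).  The default value of u^g cannot interfere: the zero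
    function has determinant 0, which differs from f, so J would be positive.

    Hence every minimizer h has J(h) = 0, u^h is the solution of the
    Monge-Ampere problem, and h = Delta u^h - 2 sqrt f is determined by it, first
    inside the domain and then on its closure by continuity. *)

Set Implicit Arguments.
Unset Strict Implicit.
Unset Printing Implicit Defensive.

Import Order.TTheory GRing.Theory Num.Theory.
Import numFieldNormedType.Exports.

Local Open Scope classical_set_scope.
Local Open Scope ring_scope.

(** * Derivatives along lines *)

(** Restriction to a line turns directional derivatives into derivatives of
    functions of one real variable, to which the mean value theorem applies. *)
Lemma is_derive_slice (R : realType) (V : normedModType R) (u : V -> R)
    (x v : V) (t d : R) :
  is_derive (x + t *: v) v u d -> is_derive t 1 (fun s => u (x + s *: v)) d.
Proof.
move=> [du dE].
have E : (fun h => h^-1 *: (((fun s => u (x + s *: v)) \o shift t) (h *: 1)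
             - u (x + t *: v)))
       = (fun h => h^-1 *: ((u \o shift (x + t *: v)) (h *: v)
             - u (x + t *: v))).
  apply/funext => h /=; congr (_ *: (u _ - _)).
  by rewrite [h *: 1]mulr1 scalerDl addrCA.
by split; [rewrite /derivable E|rewrite /derive E].
Qed.

Lemma derivable_slice_continuous (R : realType) (phi dphi : R -> R) (a b : R) :
  (forall t, a <= t <= b -> is_derive t 1 phi (dphi t)) ->
  {within `[a, b], continuous phi}.
Proof.
move=> dphiE; apply: derivable_within_continuous => t; rewrite in_itv /= => tab.
by have [] := dphiE t tab.
Qed.

(** The mean value theorem rewrites the slopes over [a, c] and [c, b] as values of
    the increasing function dphi at points of ]a, c[ and ]c, b[.  Clearing the
    denominators of the slope inequality avoids divisions later. *)
Lemma strict_convex_slope (R : realType) (phi dphi ddphi : R -> R) (a c b : R) :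
  a < c -> c < b ->
  (forall t, a <= t <= b -> is_derive t 1 phi (dphi t)) ->
  (forall t, a <= t <= b -> is_derive t 1 dphi (ddphi t)) ->
  (forall t, a <= t <= b -> 0 < ddphi t) ->
  (phi c - phi a) * (b - c) < (phi b - phi c) * (c - a).
Proof.
move=> ac cb d1 d2 pos.
have mvt (g dg : R -> R) p q : a <= p -> p < q -> q <= b ->
    (forall t, a <= t <= b -> is_derive t 1 g (dg t)) ->
    exists2 s, p < s < q & g q - g p = dg s * (q - p).
  move=> ap pq qb dgE.
  have sub t : p <= t <= q -> a <= t <= b by move=> ?; lra.
  have [||s] := @MVT R g dg p q pq.
  - move=> t; rewrite in_itv /= => tpq; apply: dgE.
    by apply: sub; lra.
  - apply: (@derivable_slice_continuous _ _ dg) => t /sub; exact: dgE.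
  - by rewrite in_itv /= => spq ->; exists s.
have [s sac ->] := mvt _ _ a c (lexx _) ac (ltW cb) d1.
have [r rcb ->] := mvt _ _ c b (ltW ac) cb (lexx _) d1.
have sr : s < r by lra.
have [||m msr E] := mvt dphi ddphi s r _ sr _ d2; try lra.
have : 0 < ddphi m * (r - s).
  by rewrite mulr_gt0 ?subr_gt0 //; apply: pos; lra.
rewrite -E subr_gt0 => dlt.
have cap : 0 < (c - a) * (b - c) by rewrite mulr_gt0 // subr_gt0.
by rewrite -mulrA [(_ * _) * (c - a)]mulrAC -mulrA ltr_pM2r.
Qed.

Lemma MVT_line (R : realType) (V : normedModType R) (u : V -> R) (x v : V)
    (h : R) :
  (forall s : R, `|s| <= `|h| -> derivable u (x + s *: v) v) ->
  exists2 s : R, `|s| <= `|h| & u (x + h *: v) - u x = h * 'D_v u (x + s *: v).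
Proof.
move=> du; pose phi (s : R) : R := u (x + s *: v).
pose dphi (s : R) : R := 'D_v u (x + s *: v).
have dphiE (s : R) : `|s| <= `|h| -> is_derive s 1 phi (dphi s).
  by move=> sh; apply: is_derive_slice; apply: derivableP; apply: du.
have u0 : u x = phi 0 by rewrite /phi scale0r addr0.
case: (leP 0 h) => h0.
- have [||s] := @MVT_segment R phi dphi 0 h h0.
  + move=> s; rewrite in_itv /= => sh; apply: dphiE.
    by rewrite !ger0_norm; lra.
  + apply: (@derivable_slice_continuous _ _ dphi) => s sh; apply: dphiE.
    by rewrite !ger0_norm; lra.
  + rewrite in_itv /= => sh E; exists s; first by rewrite !ger0_norm; lra.
    by rewrite u0 -/(phi h) E subr0 mulrC.
- have [||s] := @MVT_segment R phi dphi h 0 (ltW h0).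
  + move=> s; rewrite in_itv /= => sh; apply: dphiE.
    by rewrite !ler0_norm; lra.
  + apply: (@derivable_slice_continuous _ _ dphi) => s sh; apply: dphiE.
    by rewrite !ler0_norm; lra.
  + rewrite in_itv /= => sh E; exists s; first by rewrite !ler0_norm; lra.
    by rewrite u0 -/(phi h) -[LHS]opprB E -/(dphi s); ring.
Qed.

(** The chain rule of one real variable, applied on the line through x directed
    by v. *)
Lemma is_derive_comp_real (R : realType) (V : normedModType R) (u : V -> R)
    (phi : R -> R) (x v : V) (d e : R) :
  is_derive x v u d -> is_derive (u x) 1 phi e ->
  is_derive x v (fun y => phi (u y)) (e * d).
Proof.
move=> du dphi.
pose U (h : R) : R := u (h *: v + x).
have U0 : U 0 = u x by rewrite /U scale0r add0r.
have dU : is_derive (0 : R) 1 U d.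
  have -> : U = (fun s => u (x + s *: v)).
    by apply/funext => h; rewrite /U addrC.
  by apply: is_derive_slice; rewrite scale0r addr0.
have dpU : is_derive (0 : R) 1 (phi \o U) (e * d).
  by apply: is_derive1_comp; rewrite U0.
have E : (fun h : R => h^-1 *: (((fun y => phi (u y)) \o shift x) (h *: v)
             - phi (u x)))
       = (fun h : R => h^-1 *: (((phi \o U) \o shift 0) (h *: 1)
             - (phi \o U) 0)).
  by apply/funext => h /=; rewrite U0 /U addr0 [h *: 1]mulr1.
case: dpU => cU eU; split; first by rewrite /derivable E.
by rewrite /derive E.
Qed.

Lemma is_derive_rsqrt (R : realType) (y : R) : 0 < y ->
  is_derive y 1 (fun z => (Num.sqrt z)^-1)
   (- 2^-1 * ((Num.sqrt y)^-1 * ((Num.sqrt y)^-1 * (Num.sqrt y)^-1))).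
Proof.
move=> y0; have s0 : Num.sqrt y != 0 by rewrite gt_eqF // sqrtr_gt0.
have [ds es] := is_derive1_sqrt y0.
split; first exact: derivableV.
rewrite deriveV // es.
rewrite /GRing.scale /=.
by field.
Qed.

Lemma strict_convex_segment (R : realType) (V : normedModType R)
    (u : V -> R) (x v : V) (a c b : R) :
  a < c -> c < b ->
  (forall t, a <= t <= b -> [/\ derivable u (x + t *: v) v,
     derivable ('D_v u) (x + t *: v) v & 0 < 'D_v ('D_v u) (x + t *: v)]) ->
  (u (x + c *: v) - u (x + a *: v)) * (b - c) <
  (u (x + b *: v) - u (x + c *: v)) * (c - a).
Proof.
move=> ac cb H.
pose d1 (s : R) : R := 'D_v u (x + s *: v).
pose d2 (s : R) : R := 'D_v ('D_v u) (x + s *: v).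
have D1 t : a <= t <= b -> is_derive t 1 (fun s => u (x + s *: v)) (d1 t).
  by move=> /H [h _ _]; apply/is_derive_slice/derivableP; exact: h.
have D2 t : a <= t <= b -> is_derive t 1 d1 (d2 t).
  move=> /H [_ h _]; apply: (@is_derive_slice R V ('D_v u)).
  by apply/derivableP; exact: h.
have D3 t : a <= t <= b -> 0 < d2 t by move=> /H [_ _ h]; exact: h.
exact: (strict_convex_slope ac cb D1 D2 D3).
Qed.

(** * Mixed second derivatives and directional derivatives *)

Lemma nbhs_norm_lt (R : realType) (V : normedModType R) (x : V) (P : set V) :
  nbhs x P -> exists2 r : R, 0 < r & forall k, `|k| < r -> P (x + k).
Proof.
move=> /nbhs_ballP [r /= r0 rP]; exists r => // k kr.
by apply: rP; rewrite -ball_normE /= opprD addNKr normrN.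
Qed.

(** Used to differentiate first differences such as y |-> u (y + c) - u y. *)
Lemma is_derive_translate (R : realType) (V : normedModType R) (u : V -> R)
    (x c v : V) (d : R) :
  is_derive (x + c) v u d -> is_derive x v (fun y => u (y + c)) d.
Proof.
move=> [du dE].
have E : (fun h => h^-1 *: (((fun y => u (y + c)) \o shift x) (h *: v)
             - u (x + c)))
       = (fun h => h^-1 *: ((u \o shift (x + c)) (h *: v) - u (x + c))).
  by apply/funext => h /=; rewrite addrA.
by split; [rewrite /derivable E|rewrite /derive E].
Qed.

(** Two applications of the mean value theorem, first to the first difference
    y |-> u (y + h v) - u y in the direction w and then to 'D_w u in the
    direction v, turn the second difference into h^2 times 'D_v ('D_w u) at a
    point that tends to x. *)
Lemma second_difference_cvg (R : realType) (V : normedModType R) (u : V -> R)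
    (x v w : V) :
  (\forall y \near x, derivable u y w) ->
  (\forall y \near x, derivable ('D_w u) y v) ->
  {for x, continuous ('D_v ('D_w u))} ->
  (u (x + h *: v + h *: w) - u (x + h *: v) - u (x + h *: w) + u x) / h ^+ 2
    @[h --> 0^'] --> 'D_v ('D_w u) x.
Proof.
move=> dw dvw cvw; apply/cvgrPdist_lt => e e0.
have near3 : \forall y \near x, [/\ derivable u y w, derivable ('D_w u) y v &
    `|'D_v ('D_w u) x - 'D_v ('D_w u) y| < e].
  move/cvgrPdist_lt : cvw => /(_ e e0) cve.
  by apply: filterS3 dw dvw cve => y Hw Hvw He; split.
have [r r0 rP] := nbhs_norm_lt near3.
pose M := `|v| + `|w| + 1.
have M0 : 0 < M by rewrite ltr_wpDl ?addr_ge0.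
near=> h.
have h0 : h != 0 by near: h; exact: nbhs_dnbhs_neq.
have hr : `|h| * M < r.
  by rewrite -ltr_pdivlMr //; near: h; apply: dnbhs0_lt; exact: divr_gt0.
have small (s t : R) : `|s| <= `|h| -> `|t| <= `|h| ->
    `|s *: v + t *: w| < r.
  move=> sh th; apply: le_lt_trans hr; apply: (le_trans (ler_normD _ _)).
  rewrite !normrZ /M !mulrDr mulr1 -[leLHS]addr0.
  by rewrite lerD // lerD // ler_wpM2r.
pose G y := u (y + h *: v) - u y.
have dG s : `|s| <= `|h| -> is_derive (x + s *: w) w G
   ('D_w u (x + s *: w + h *: v) - 'D_w u (x + s *: w)).
  move=> sh; apply: is_deriveB.
    apply/is_derive_translate/derivableP.
    rewrite -addrA [_ *: w + _]addrC.
    by case: (rP _ (small h s (lexx _) sh)) => H _ _; exact: H.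
  apply: derivableP; have := rP _ (small 0 s _ sh).
  by rewrite normr0 scale0r add0r => /(_ (normr_ge0 _)) [H _ _]; exact: H.
have [s sh sE] : exists2 s : R, `|s| <= `|h| &
    G (x + h *: w) - G x = h * 'D_w G (x + s *: w).
  by apply: MVT_line => s sh; case: (dG s sh).
have [t th tE] : exists2 t : R, `|t| <= `|h| &
    'D_w u (x + s *: w + h *: v) - 'D_w u (x + s *: w)
      = h * 'D_v ('D_w u) (x + s *: w + t *: v).
  apply: (@MVT_line R V ('D_w u) (x + s *: w) v h) => t th.
  rewrite -addrA [_ *: w + _]addrC.
  by case: (rP _ (small t s th sh)) => _ H _; exact: H.
have -> : u (x + h *: v + h *: w) - u (x + h *: v) - u (x + h *: w) + u x =
    h * (h * 'D_v ('D_w u) (x + s *: w + t *: v)).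
  rewrite -tE -(derive_val (is_derive := dG s sh)) -sE /G.
  by rewrite [x + h *: w + _]addrAC; ring.
rewrite mulrA -expr2 mulrAC divff ?expf_neq0 // mul1r.
rewrite -addrA [_ *: w + _]addrC.
by case: (rP _ (small t s th sh)) => _ _ H; exact: H.
Unshelve. all: by end_near. Qed.

(** Schwarz's theorem: the second difference is symmetric in v and w, so
    both mixed derivatives are its limit. *)
Lemma derive_derive_comm (R : realType) (V : normedModType R) (u : V -> R)
    (x v w : V) :
  (\forall y \near x, derivable u y v) ->
  (\forall y \near x, derivable u y w) ->
  (\forall y \near x, derivable ('D_w u) y v) ->
  (\forall y \near x, derivable ('D_v u) y w) ->
  {for x, continuous ('D_v ('D_w u))} ->
  {for x, continuous ('D_w ('D_v u))} ->
  'D_v ('D_w u) x = 'D_w ('D_v u) x.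
Proof.
move=> dv dw dwv dvw cvw cwv.
move: (second_difference_cvg dv dvw cwv) (second_difference_cvg dw dwv cvw).
move: ('D_v ('D_w u) x) ('D_w ('D_v u) x) => a b Lb La.
have E : (fun h : R => (u (x + h *: w + h *: v) - u (x + h *: w)
     - u (x + h *: v) + u x) / h ^+ 2) =
   (fun h : R => (u (x + h *: v + h *: w) - u (x + h *: v)
     - u (x + h *: w) + u x) / h ^+ 2).
  apply/funext => h; congr (_ / _); congr (_ + _).
  by rewrite [x + _ + h *: v]addrAC [LHS]addrAC.
rewrite E in Lb.
exact: (cvg_unique _ La Lb).
Qed.

Lemma basis2_decomposition (R : realType) (v : R * R) :
  v = v.1 *: basis2 R 0 + v.2 *: basis2 R 1.
Proof.
case: v => a b; rewrite /basis2 /=; apply/eqP/andP; rewrite /= /GRing.scale /=.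
by rewrite !mulr1 !mulr0 addr0 add0r.
Qed.

(** Continuous partial derivatives give all directional derivatives: the
    increment along h v is split into a step parallel to each axis, and the mean
    value theorem is applied to each step. *)
Lemma is_derive_direction (R : realType) (u : R * R -> R) (x v : R * R) :
  (forall i, \forall y \near x, derivable u y (basis2 R i)) ->
  (forall i, {for x, continuous (partial i u)}) ->
  is_derive x v u (v.1 * partial 0 u x + v.2 * partial 1 u x).
Proof.
move=> du cu; set L := _ + _.
suff cv : h^-1 *: ((u \o shift x) (h *: v) - u x) @[h --> 0^'] --> L.
  by split; [apply/cvg_ex; exists L|apply: cvg_lim].
apply/cvgrPdist_lt => e e0.
pose M := `|v.1| + `|v.2| + 1.
have M0 : 0 < M by rewrite ltr_wpDl ?addr_ge0.
pose d := e / M; have d0 : 0 < d by exact: divr_gt0.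
have near4 i : \forall y \near x, derivable u y (basis2 R i) /\
    `|partial i u x - partial i u y| < d.
  move/cvgrPdist_lt : (cu i) => /(_ d d0) cud.
  by apply: filterS2 (du i) cud => y Hd Hc; split.
have [r0 r0_gt0 r0P] := nbhs_norm_lt (near4 0).
have [r1 r1_gt0 r1P] := nbhs_norm_lt (near4 1).
set e1 := basis2 R 0; set e2 := basis2 R 1.
pose N := `|v.1| * `|e1| + `|v.2| * `|e2| + 1.
have N0 : 0 < N by rewrite ltr_wpDl ?addr_ge0 ?mulr_ge0.
pose r := Order.min r0 r1.
have r_gt0 : 0 < r by rewrite lt_min r0_gt0.
near=> h.
have h0 : h != 0 by near: h; exact: nbhs_dnbhs_neq.
have hr : `|h| * N < r.
  by rewrite -ltr_pdivlMr //; near: h; apply: dnbhs0_lt; exact: divr_gt0.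
have small (s t : R) : `|s| <= `|h * v.1| -> `|t| <= `|h * v.2| ->
    `|s *: e1 + t *: e2| < r.
  move=> sh th; apply: le_lt_trans hr; apply: (le_trans (ler_normD _ _)).
  rewrite !normrZ /N !mulrDr mulr1 -[leLHS]addr0 !mulrA -!normrM.
  by rewrite lerD // lerD // ler_wpM2r.
have small0 s t : `|s| <= `|h * v.1| -> `|t| <= `|h * v.2| ->
    `|s *: e1 + t *: e2| < r0.
  by move=> sh th; have := small _ _ sh th; rewrite lt_min => /andP[].
have small1 s t : `|s| <= `|h * v.1| -> `|t| <= `|h * v.2| ->
    `|s *: e1 + t *: e2| < r1.
  by move=> sh th; have := small _ _ sh th; rewrite lt_min => /andP[].
have [s sh sE] : exists2 s : R, `|s| <= `|h * v.1| &
    u (x + (h * v.2) *: e2 + (h * v.1) *: e1) - u (x + (h * v.2) *: e2) =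
    h * v.1 * 'D_e1 u (x + (h * v.2) *: e2 + s *: e1).
  apply: MVT_line => s sh; rewrite -addrA [_ *: e2 + _]addrC.
  by case: (r0P _ (small0 _ _ sh (lexx _))) => H _; exact: H.
have [t th tE] : exists2 t : R, `|t| <= `|h * v.2| &
    u (x + (h * v.2) *: e2) - u x = h * v.2 * 'D_e2 u (x + t *: e2).
  apply: MVT_line => t th.
  have := r1P _ (small1 0 t _ th).
  by rewrite normr0 scale0r add0r => /(_ (normr_ge0 _)) [H _]; exact: H.
have -> : (u \o shift x) (h *: v) - u x =
    h * (v.1 * 'D_e1 u (x + (h * v.2) *: e2 + s *: e1)
        + v.2 * 'D_e2 u (x + t *: e2)).
  rewrite mulrDr !mulrA -sE -tE addrA subrK; congr (u _ - _) => /=.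
  rewrite [in LHS](basis2_decomposition v) scalerDr !scalerA -/e1 -/e2.
  by rewrite [LHS]addrC addrA addrAC.
rewrite [_^-1 *: _]mulKf //.
have H1 : `|partial 0 u x - 'D_e1 u (x + (h * v.2) *: e2 + s *: e1)| < d.
  rewrite -addrA [_ *: e2 + _]addrC.
  by case: (r0P _ (small0 _ _ sh (lexx _))) => _ H; exact: H.
have H2 : `|partial 1 u x - 'D_e2 u (x + t *: e2)| < d.
  have := r1P _ (small1 0 t _ th).
  by rewrite normr0 scale0r add0r => /(_ (normr_ge0 _)) [_ H]; exact: H.
rewrite /L opprD addrACA -!mulrBr.
apply: (le_lt_trans (ler_normD _ _)); rewrite !normrM.
have -> : e = d * M by rewrite /d divfK // gt_eqF.
rewrite /M 2!mulrDr mulr1 -[ltLHS]addr0; apply: ler_ltD => //.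
by rewrite lerD // mulrC ler_wpM2r // ltW.
Unshelve. all: by end_near. Qed.

(** * Smoothness up to the boundary *)

Definition extends_continuously (R : realType) (O : set (R * R))
    (u : R * R -> R) : Prop :=
  exists v, {within closure O, continuous v} /\ forall x, O x -> v x = u x.

(** Functions of class C^k up to the boundary of O.  The recursion differentiates
    first and then asks for C^(k-1), the opposite of [partials], which adds
    derivatives on the outside; in this form stability under products and square
    roots follows by induction on k, without a formula for iterated
    derivatives. *)
Fixpoint Ck_closure (R : realType) (O : set (R * R)) (k : nat)
    (u : R * R -> R) : Prop :=
  extends_continuously O u /\
  if k is k'.+1 then forall i : 'I_2,
    (forall x, O x -> derivable u x (basis2 R i)) /\ Ck_closure O k' (partial i u)
  else True.

Lemma Ck_closure_extends (R : realType) (O : set (R * R)) (k : nat) u :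
  Ck_closure O k u -> extends_continuously O u.
Proof. by case: k => [|k] []. Qed.

Lemma Ck_closureW (R : realType) (O : set (R * R)) (k : nat) u :
  Ck_closure O k.+1 u -> Ck_closure O k u.
Proof.
elim: k u => [|k IH] u [eu du]; first by split.
by split=> // i; have [dui kui] := du i; split=> //; exact: IH.
Qed.

Lemma open_near_eq (R : realType) (O : set (R * R)) (u v : R * R -> R) x :
  open O -> (forall y, O y -> u y = v y) -> O x -> {near x, u =1 v}.
Proof.
move=> oO uv Ox; apply: filterS (open_nbhs_nbhs (conj oO Ox)) => y; exact: uv.
Qed.

(** Partial derivatives at a point of an open set depend only on the values in
    that set; this is what makes values outside the domain irrelevant. *)
Lemma eq_partials (R : realType) (O : set (R * R)) (u v : R * R -> R) s :
  open O -> (forall y, O y -> u y = v y) ->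
  forall x, O x -> partials s u x = partials s v x.
Proof.
move=> oO uv; elim: s => [|i s IH] x Ox //=; first exact: uv.
exact/near_eq_derive/(open_near_eq oO).
Qed.

Lemma eq_hessian (R : realType) (O : set (R * R)) (u v : R * R -> R) :
  open O -> (forall y, O y -> u y = v y) ->
  forall x, O x -> hessian u x = hessian v x.
Proof.
move=> oO uv x Ox; apply: eq_mx => i j.
exact: (@eq_partials _ O u v [:: i; j]).
Qed.

Lemma extends_continuously_continuous (R : realType) (O : set (R * R)) u x :
  open O -> extends_continuously O u -> O x -> {for x, continuous u}.
Proof.
move=> oO [v [cv vu]] Ox.
have Onx : nbhs x O by exact: open_nbhs_nbhs.
have /(subspace_continuousP (closure O)) cvx := cv.
have {}cvx := cvx x (subset_closure Ox).
have cvv : v y @[y --> x] --> v x.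
  apply: cvg_trans cvx; apply: cvg_app => A; rewrite /within /= => nA.
  near=> y; have Oy : O y by near: y.
  by move: (subset_closure Oy); near: y.
rewrite (vu x Ox) in cvv; apply: cvg_trans cvv.
by apply: near_eq_cvg; exact: (open_near_eq oO).
Unshelve. all: by end_near. Qed.

Lemma Ck_closure_eq (R : realType) (O : set (R * R)) k (u v : R * R -> R) :
  open O -> (forall x, O x -> u x = v x) ->
  Ck_closure O k u -> Ck_closure O k v.
Proof.
move=> oO.
have ext w w' : (forall x, O x -> w x = w' x) ->
    extends_continuously O w -> extends_continuously O w'.
  by move=> ww' [z [cz zw]]; exists z; split=> // x Ox; rewrite zw // ww'.
elim: k u v => [|k IH] u v uv [eu du]; split=> //; try exact: ext eu.
move=> i; have [dui kui] := du i; split.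
  move=> x Ox; apply: near_eq_derivable (dui x Ox).
  exact: (open_near_eq oO).
apply: IH kui => x Ox; exact: (@eq_partials _ O u v [:: i]).
Qed.

Lemma Ck_closure_cst (R : realType) (O : set (R * R)) k (c : R) :
  Ck_closure O k (cst c).
Proof.
have ext a : extends_continuously O (cst a).
  by exists (cst a); split=> // x; exact: cst_continuous.
elim: k c => [|k IH] c; (split; first exact: ext) => // i; split=> [x _|].
  exact: derivable_cst.
suff -> : partial i (cst c) = cst 0 :> (R * R -> R) by exact: IH.
by apply/funext => x; rewrite /partial derive_cst.
Qed.

Lemma Ck_closureD (R : realType) (O : set (R * R)) k (u v : R * R -> R) :
  open O -> Ck_closure O k u -> Ck_closure O k v ->
  Ck_closure O k (fun x => u x + v x).
Proof.
move=> oO; have ext w w' : extends_continuously O w ->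
    extends_continuously O w' -> extends_continuously O (fun x => w x + w' x).
  move=> [z [cz zw]] [z' [cz' zw']]; exists (fun x => z x + z' x).
  split=> [|x Ox]; last by rewrite zw // zw'.
  by move=> x; apply: cvgD; [exact: cz|exact: cz'].
elim: k u v => [|k IH] u v [eu du] [ev dv]; split=> //; try exact: ext.
move=> i; have [dui kui] := du i; have [dvi kvi] := dv i; split.
  move=> x Ox; apply: derivableD; [exact: dui|exact: dvi].
apply: Ck_closure_eq (IH _ _ kui kvi) => // x Ox.
by rewrite /partial -deriveD //; [exact: dui|exact: dvi].
Qed.

Lemma Ck_closureM (R : realType) (O : set (R * R)) k (u v : R * R -> R) :
  open O -> Ck_closure O k u -> Ck_closure O k v ->
  Ck_closure O k (fun x => u x * v x).
Proof.
move=> oO; have ext w w' : extends_continuously O w ->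
    extends_continuously O w' -> extends_continuously O (fun x => w x * w' x).
  move=> [z [cz zw]] [z' [cz' zw']]; exists (fun x => z x * z' x).
  split=> [|x Ox]; last by rewrite zw // zw'.
  by move=> x; apply: cvgM; [exact: cz|exact: cz'].
elim: k u v => [|k IH] u v ku kv;
  have [eu du] := ku; have [ev dv] := kv; split=> //; try exact: ext.
move=> i; have [dui kui] := du i; have [dvi kvi] := dv i; split.
  move=> x Ox; apply: derivableM; [exact: dui|exact: dvi].
have uv' := IH _ _ (Ck_closureW ku) kvi.
have vu' := IH _ _ (Ck_closureW kv) kui.
apply: Ck_closure_eq (Ck_closureD oO uv' vu') => // x Ox.
by rewrite /partial -deriveM //; [exact: dui|exact: dvi].
Qed.

(** The induction closes up because the derivative of f^(-1/2) is
    -1/2 f' (f^(-1/2))^3, a product of functions already known to be C^k.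
    Positivity of f on the closure, and not only on O, makes f^(-1/2) extend
    continuously. *)
Lemma Ck_closure_rsqrt (R : realType) (O : set (R * R)) k (f : R * R -> R) :
  open O -> {within closure O, continuous f} ->
  (forall x, closure O x -> 0 < f x) -> Ck_closure O k f ->
  Ck_closure O k (fun x => (Num.sqrt (f x))^-1).
Proof.
move=> oO cf fpos.
have ext : extends_continuously O (fun x => (Num.sqrt (f x))^-1).
  exists (fun x => (Num.sqrt (f x))^-1); split=> //.
  apply/subspace_continuousP => x clx.
  apply: cvgV; first by rewrite gt_eqF // sqrtr_gt0 fpos.
  apply: continuous_cvg; first exact: sqrt_continuous.
  by have /(subspace_continuousP (closure O)) := cf; apply.
elim: k => [|k IH] kf; split=> // i.
have kg := IH (Ck_closureW kf); have [_ /(_ i) [dfi kfi]] := kf.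
have dg x : O x -> is_derive x (basis2 R i) (fun y => (Num.sqrt (f y))^-1)
    (partial i f x * (- 2^-1 * ((Num.sqrt (f x))^-1 *
      ((Num.sqrt (f x))^-1 * (Num.sqrt (f x))^-1)))).
  move=> Ox; rewrite mulrC.
  apply: (@is_derive_comp_real R _ f (fun z => (Num.sqrt z)^-1)).
    by apply: derivableP; exact: dfi.
  by apply: is_derive_rsqrt; apply: fpos; exact: subset_closure.
split=> [x Ox|]; first by case: (dg x Ox).
apply: Ck_closure_eq (Ck_closureM oO kfi (Ck_closureM oO
  (Ck_closure_cst O k (- 2^-1)) (Ck_closureM oO kg (Ck_closureM oO kg kg))))
  => // x Ox.
by rewrite /partial (derive_val (is_derive := dg x Ox)).
Qed.

Lemma smooth_closure_Ck (R : realType) (O : set (R * R)) (u : R * R -> R) :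
  smooth_closure O u -> forall s k, Ck_closure O k (partials s u).
Proof.
move=> [su _ eu] s k; elim: k s => [|k IH] s; split=> //; try exact: eu.
move=> i; split; last exact: (IH (i :: s)).
by move=> x Ox; have [_ /(_ i)] := su s x Ox.
Qed.

Lemma Ck_smooth_closure (R : realType) (O : set (R * R)) (u : R * R -> R) :
  open O -> {within closure O, continuous u} ->
  (forall k, Ck_closure O k u) -> smooth_closure O u.
Proof.
move=> oO cu ku.
have ks s k : Ck_closure O k (partials s u).
  elim: s k => [|i s IH] k //=.
  by have [_ /(_ i) []] := IH k.+1.
split=> // [s x Ox|s]; last exact: Ck_closure_extends (ks s 0%N).
split; last by move=> i; have [_ /(_ i) [ds _]] := ks s 1%N; exact: ds.
exact: extends_continuously_continuous oO (Ck_closure_extends (ks s 0%N)) Ox.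
Qed.

(** A function defined by derivatives inside O need not be continuous up to the
    boundary for its own values there; it has to be replaced by its continuous
    extension. *)
Lemma Ck_closure_extension (R : realType) (O : set (R * R)) (u : R * R -> R) :
  open O -> (forall k, Ck_closure O k u) ->
  exists g, smooth_closure O g /\ forall x, O x -> g x = u x.
Proof.
move=> oO ku; have [g [cg gu]] := Ck_closure_extends (ku 0%N).
exists g; split=> //; apply: Ck_smooth_closure => // k.
by apply: Ck_closure_eq (ku k) => // x Ox; rewrite gu.
Qed.

Lemma closure_ge0 (R : realType) (O : set (R * R)) (g : R * R -> R) :
  {within closure O, continuous g} -> (forall x, O x -> 0 <= g x) ->
  forall x, closure O x -> 0 <= g x.
Proof.
move=> cg g0 x clx; rewrite leNgt; apply/negP => gx0.
have /(subspace_continuousP (closure O)) /(_ x clx) cgx := cg.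
have /cvgrPdist_lt /(_ (- g x)) := cgx; rewrite oppr_gt0 => /(_ gx0) near_x.
have [y [Oy yP]] := clx _ near_x.
have := yP (subset_closure Oy); have gy0 := g0 y Oy.
rewrite ler0_norm; last by rewrite subr_le0 (le_trans (ltW gx0)).
by rewrite opprB ltrBlDr addNr ltNge gy0.
Qed.

Lemma eq_closure (R : realType) (O : set (R * R)) (g h : R * R -> R) :
  {within closure O, continuous g} -> {within closure O, continuous h} ->
  (forall x, O x -> g x = h x) -> forall x, closure O x -> g x = h x.
Proof.
move=> cg ch gh x clx.
have le (a b : R * R -> R) : {within closure O, continuous a} ->
    {within closure O, continuous b} -> (forall y, O y -> a y = b y) ->
    a x <= b x.
  move=> ca cb ab; rewrite -subr_ge0.
  apply: (@closure_ge0 _ O (fun y => b y - a y)) clx.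
    by move=> y; apply: cvgB; [exact: cb|exact: ca].
  by move=> y Oy; rewrite ab // subrr.
apply/eqP; rewrite eq_le !le // => y Oy.
by rewrite gh.
Qed.

Lemma smooth_closure_cst (R : realType) (O : set (R * R)) (c : R) :
  open O -> smooth_closure O (cst c).
Proof.
move=> oO; apply: Ck_smooth_closure => // [|k]; last exact: Ck_closure_cst.
by move=> x; exact: cst_continuous.
Qed.

(** * The Hessian of a smooth function on the plane *)

Lemma laplacianE (R : realType) (u : R * R -> R) x :
  laplacian u x = partial 0 (partial 0 u) x + partial 1 (partial 1 u) x.
Proof.
rewrite /laplacian /mxtrace big_ord_recl big_ord1 !mxE.
by congr (_ + partial _ (partial _ u) x); apply: val_inj.
Qed.

Lemma det_mx22 (R : comPzRingType) (A : 'M[R]_2) :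
  \det A = A 0 0 * A 1 1 - A 0 1 * A 1 0.
Proof.
have l0 : lift 0 0 = 1 :> 'I_2 by exact: val_inj.
have l1 : lift 1 0 = 0 :> 'I_2 by exact: val_inj.
rewrite (expand_det_row _ 0) big_ord_recl big_ord1 /cofactor !det_mx11 !mxE.
by rewrite !l0 l1 /= expr0 expr1 mul1r mulN1r mulrN.
Qed.

Lemma det_hessianE (R : realType) (u : R * R -> R) x :
  \det (hessian u x) =
  partial 0 (partial 0 u) x * partial 1 (partial 1 u) x -
  partial 0 (partial 1 u) x * partial 1 (partial 0 u) x.
Proof. by rewrite det_mx22 !mxE. Qed.

Lemma smooth_near_derivable (R : realType) (O : set (R * R)) u s i x :
  open O -> smooth_on O u -> O x ->
  \forall y \near x, derivable (partials s u) y (basis2 R i).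
Proof.
move=> oO su Ox; apply: filterS (open_nbhs_nbhs (conj oO Ox)) => y Oy.
by have [_] := su s y Oy; apply.
Qed.

Lemma partial_comm (R : realType) (O : set (R * R)) u i j x :
  open O -> smooth_on O u -> O x ->
  partial i (partial j u) x = partial j (partial i u) x.
Proof.
move=> oO su Ox.
have nd s k := @smooth_near_derivable R O u s k x oO su Ox.
have [c1 _] := su [:: i; j] x Ox.
have [c2 _] := su [:: j; i] x Ox.
exact: (@derive_derive_comm R _ u x (basis2 R i) (basis2 R j)
  (nd [::] i) (nd [::] j) (nd [:: j] i) (nd [:: i] j) c1 c2).
Qed.

Lemma det_hessian_smooth (R : realType) (O : set (R * R)) u x :
  open O -> smooth_on O u -> O x ->
  \det (hessian u x) =
  partial 0 (partial 0 u) x * partial 1 (partial 1 u) x -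
  partial 0 (partial 1 u) x * partial 0 (partial 1 u) x.
Proof.
move=> oO su Ox; rewrite det_hessianE.
have := @partial_comm R O u 1 0 x oO su Ox.
by move: (partial 1 (partial 0 u) x) => c ->.
Qed.

Lemma partials_lincomb (R : realType) (O : set (R * R)) u v (c : R) s x :
  open O -> smooth_on O u -> smooth_on O v -> O x ->
  partials s (fun y => u y + c * v y) x = partials s u x + c * partials s v x.
Proof.
move=> oO su sv; elim: s x => [|i s IH] x Ox //=.
have [_ /(_ i) du] := su s x Ox; have [_ /(_ i) dv] := sv s x Ox.
have D : is_derive x (basis2 R i) (fun y => partials s u y + c * partials s v y)
    (partial i (partials s u) x + c * partial i (partials s v) x).
  apply: is_deriveD; first exact: (derivableP du).
  exact: (is_deriveZ _ (derivableP dv)).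
rewrite -(derive_val (is_derive := D)).
exact/near_eq_derive/(open_near_eq oO).
Qed.

Lemma smooth_closure_lincomb (R : realType) (O : set (R * R)) u v (c : R) :
  open O -> smooth_closure O u -> smooth_closure O v ->
  smooth_closure O (fun y => u y + c * v y).
Proof.
move=> oO su sv; apply: Ck_smooth_closure => //.
  have [_ cu _] := su; have [_ cv _] := sv.
  move=> x; apply: cvgD; first exact: cu.
  by apply: cvgM; [exact: cvg_cst|exact: cv].
move=> k; apply: Ck_closureD => //; first exact: (smooth_closure_Ck su [::]).
apply: Ck_closureM => //; first exact: (Ck_closure_cst O k c).
exact: (smooth_closure_Ck sv [::]).
Qed.

Lemma laplacian_lincomb (R : realType) (O : set (R * R)) u v (c : R) x :
  open O -> smooth_on O u -> smooth_on O v -> O x ->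
  laplacian (fun y => u y + c * v y) x = laplacian u x + c * laplacian v x.
Proof.
move=> oO su sv Ox; rewrite !laplacianE.
have E i := @partials_lincomb R O u v c [:: i; i] x oO su sv Ox.
by rewrite /= in E; rewrite !E mulrDr addrACA.
Qed.

Lemma det_hessian_cst (R : realType) (c : R) (x : R * R) :
  \det (hessian (cst c) x) = 0.
Proof.
have p0 i a : partial i (cst a) = cst 0 :> (R * R -> R).
  by apply/funext => y; rewrite /partial derive_cst.
by rewrite det_hessianE !p0 /= mul0r subrr.
Qed.

(** The second derivative in the direction v is the Hessian quadratic form at v,
    by [is_derive_direction] applied to u and then to its partial
    derivatives. *)
Lemma is_derive_second_direction (R : realType) (O : set (R * R)) u (x v : R * R) :
  open O -> smooth_on O u -> O x ->
  derivable u x v /\ is_derive x v ('D_v u)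
    (partial 0 (partial 0 u) x * v.1 ^+ 2
     + 2 * partial 0 (partial 1 u) x * v.1 * v.2
     + partial 1 (partial 1 u) x * v.2 ^+ 2).
Proof.
move=> oO su Ox.
have D1 s y : O y -> is_derive y v (partials s u)
    (v.1 * partials (0 :: s) u y + v.2 * partials (1 :: s) u y).
  move=> Oy; apply: is_derive_direction => i.
    exact: (smooth_near_derivable _ _ oO su Oy).
  by have [cs _] := su (i :: s) y Oy; exact: cs.
split; first by case: (D1 [::] x Ox).
have D2 : is_derive x v (fun y => v.1 * partials [:: 0] u y
    + v.2 * partials [:: 1] u y)
  (v.1 * (v.1 * partials [:: 0; 0] u x + v.2 * partials [:: 1; 0] u x) +
   v.2 * (v.1 * partials [:: 0; 1] u x + v.2 * partials [:: 1; 1] u x)).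
  by apply: is_deriveD; apply: is_deriveZ; exact: D1.
have nE : {near x, (fun y => v.1 * partials [:: 0] u y
    + v.2 * partials [:: 1] u y) =1 'D_v u}.
  apply: (open_near_eq oO) => // y Oy.
  by rewrite -(derive_val (is_derive := D1 [::] y Oy)).
have D3 := near_eq_is_derive nE D2.
apply: is_derive_eq D3 _; rewrite /=.
have := @partial_comm R O u 1 0 x oO su Ox.
move: (partial 1 (partial 0 u) x) => c ->.
move: (partial 0 (partial 0 u) x) (partial 1 (partial 1 u) x) => a d.
by move: (partial 0 (partial 1 u) x) => b; ring.
Qed.

(** * The maximum principle and uniqueness for the Poisson problem *)

Lemma bounded_closure_compact (R : realType) (O : set (R * R)) :
  bounded_set O -> compact (closure O).
Proof.
move=> [M [_ OM]].
have OM1 : O `<=` `[- (M + 1), M + 1]%classic `*` `[- (M + 1), M + 1]%classic.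
  move=> x Ox; have := OM (M + 1) _ x Ox; rewrite ltrDl => /(_ ltr01) /=.
  rewrite [X in X <= _]/(Num.max `|x.1| `|x.2|) ge_max => /andP[].
  by rewrite !ler_norml => x1 x2; split; rewrite /= in_itv.
have cK := @segment_compact R (- (M + 1)) (M + 1).
have cKK := compact_setX cK cK.
apply: (subclosed_compact _ cKK); first exact: closed_closure.
have /closure_id -> : closed
  (`[- (M + 1), M + 1]%classic `*` `[- (M + 1), M + 1]%classic : set (R * R)).
  exact: (compact_closed _ cKK).
exact: closure_subset.
Qed.

(** A positive second derivative at one point stays positive nearby, so u is
    strictly convex on a short segment centred at x.  The neighbourhood P lets the
    caller keep the segment inside the domain. *)
Lemma near_midpoint_strict_convex (R : realType) (V : normedModType R)
    (u : V -> R) (x v : V) (P : set V) :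
  (\forall y \near x, P y) ->
  (\forall y \near x, derivable u y v) ->
  (\forall y \near x, derivable ('D_v u) y v) ->
  {for x, continuous ('D_v ('D_v u))} -> 0 < 'D_v ('D_v u) x ->
  exists2 t : R, 0 < t & [/\ P (x + t *: v), P (x - t *: v) &
    2 * u x < u (x + t *: v) + u (x - t *: v)].
Proof.
move=> nP n1 n2 cu pos.
have n3 : \forall y \near x, 0 < 'D_v ('D_v u) y.
  by move/cvgr_gt : cu; apply.
have nP' : nbhs x (P `&` ((fun y => derivable u y v) `&`
    ((fun y => derivable ('D_v u) y v) `&`
     (fun y => 0 < 'D_v ('D_v u) y)))).
  exact: filterI nP (filterI n1 (filterI n2 n3)).
have [r r0 rP] := nbhs_norm_lt nP'.
have v1 : 0 < `|v| + 1 by rewrite ltr_wpDl.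
pose t := r / 2 / (`|v| + 1).
have t0 : 0 < t by rewrite !divr_gt0.
have small s : - t <= s <= t -> `|s *: v| < r.
  rewrite -ler_norml normrZ => st.
  (* t is chosen so that t (`|v| + 1) = r / 2 < r. *)
  have : `|s| * (`|v| + 1) <= t * (`|v| + 1) by rewrite ler_wpM2r // ltW.
  rewrite /t divfK ?gt_eqF // mulrDr mulr1 => h.
  have := normr_ge0 s; lra.
exists t => //.
have [Pt _] := rP _ (small t ltac:(lra)).
have [Pnt _] := rP _ (small (- t) ltac:(lra)).
have := @strict_convex_segment R V u x v (- t) 0 t.
rewrite scale0r addr0 scaleNr in Pnt *; rewrite oppr_lt0 t0.
move=> /(_ isT isT) H.
split=> //; move: H; rewrite subr0 opprK add0r ltr_pM2r // => H.
suff : u x - u (x - t *: v) < u (x + t *: v) - u x by lra.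
apply: H => s /small /rP [_ [h1 [h2 h3]]]; split; [exact: h1|exact: h2|exact: h3].
Qed.

Lemma smooth_midpoint_strict_convex (R : realType) (O : set (R * R)) u i x :
  open O -> smooth_on O u -> O x -> 0 < partial i (partial i u) x ->
  exists v, [/\ O (x + v), O (x - v) & 2 * u x < u (x + v) + u (x - v)].
Proof.
move=> oO su Ox pos.
have nd s k := @smooth_near_derivable R O u s k x oO su Ox.
have [c1 _] := su [:: i; i] x Ox.
have nO : \forall y \near x, O y by exact: open_nbhs_nbhs.
have [t _ H] := @near_midpoint_strict_convex R _ u x (basis2 R i) O nO
  (nd [::] i) (nd [:: i] i) c1 pos.
by exists (t *: basis2 R i).
Qed.

Lemma closure_open_or_boundary (T : topologicalType) (O : set T) x :
  open O -> closure O x -> O x \/ boundary O x.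
Proof.
move=> oO clx; have [Ox|nOx] := pselect (O x); first by left.
by right; split=> // /interior_subset.
Qed.

(** At an interior maximum a positive Laplacian would make one pure second
    derivative positive, hence u strictly midpoint convex there along an axis,
    against maximality.  So the maximum over the compact closure is attained on
    the boundary. *)
Lemma strict_max_principle (R : realType) (O : set (R * R)) u :
  open O -> bounded_set O -> smooth_closure O u ->
  (forall x, O x -> 0 < laplacian u x) ->
  (forall x, boundary O x -> u x <= 0) ->
  forall x, closure O x -> u x <= 0.
Proof.
move=> oO bO [su cu _] lap bd x clx.
have cK := bounded_closure_compact bO.
have [|c + cmax] := compact_EVT_max _ cK cu; first by exists x.
rewrite inE => clc.
suff uc : u c <= 0 by apply: le_trans uc; apply: cmax; rewrite inE.
case: (closure_open_or_boundary oO clc) => [Oc|]; last exact: bd.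
have [i pos] : exists i, 0 < partial i (partial i u) c.
  have split_pos (a b : R) : 0 < a + b -> 0 < a \/ 0 < b.
    by move=> ab; case: (ltP 0 a) => a0; [left|right; lra].
  have := lap c Oc; rewrite laplacianE => /split_pos.
  by case=> h; [exists 0|exists 1]; exact: h.
have [v [Opv Omv H]] := smooth_midpoint_strict_convex oO su Oc pos.
have := cmax (c + v); rewrite inE => /(_ (subset_closure Opv)) h1.
have := cmax (c - v); rewrite inE => /(_ (subset_closure Omv)) h2.
exfalso; lra.
Qed.

(** The difference u - w is only harmonic, which the strict maximum principle does
    not cover.  Since Delta w = 2 sqrt f + g is positive, u - w + e w is strictly
    subharmonic for every e > 0 and vanishes on the boundary; so it is
    nonpositive, and u > w at some point is refuted by a small e. *)
Lemma poisson_solution_le (R : realType) (O : set (R * R)) f g u w :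
  open O -> bounded_set O -> (forall x, O x -> 0 < f x) ->
  (forall x, O x -> 0 <= g x) ->
  poisson_solution O f g u -> poisson_solution O f g w ->
  forall x, closure O x -> u x <= w x.
Proof.
move=> oO bO f0 g0 [su Lu bu] [sw Lw bw] x clx.
have key (e : R) : 0 < e -> u x + (-1) * w x + e * w x <= 0.
  move=> e0.
  have sz := smooth_closure_lincomb (-1) oO su sw.
  apply: (strict_max_principle oO bO (smooth_closure_lincomb e oO sz sw)) clx.
    have [su' _ _] := su; have [sw' _ _] := sw; have [sz' _ _] := sz.
    move=> y Oy; rewrite (laplacian_lincomb _ oO) // (laplacian_lincomb _ oO) //.
    rewrite Lu // Lw // mulN1r subrr add0r mulr_gt0 // ltr_wpDr ?g0 //.
    by rewrite mulr_gt0 // sqrtr_gt0 f0.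
  by move=> y yb; rewrite bu // bw // !mulr0 !addr0.
rewrite leNgt; apply/negP => wu.
(* With this e, e `|w x| is smaller than u x - w x. *)
have e0 : 0 < (u x - w x) / 2 / (`|w x| + 1).
  by rewrite !divr_gt0 ?subr_gt0 // ltr_wpDl.
have := key _ e0; apply/negP; rewrite -ltNge.
set e := _ / _ / _ in e0 *.
have eE : e * (`|w x| + 1) = (u x - w x) / 2.
  by rewrite /e divfK // gt_eqF // ltr_wpDl.
have : - (e * `|w x|) <= e * w x.
  by rewrite -mulrN ler_pM2l // lerNl -normrN ler_norm.
move: eE; rewrite mulrDr mulr1; lra.
Qed.

Lemma poisson_solution_unique (R : realType) (O : set (R * R)) f g u w :
  open O -> bounded_set O -> (forall x, O x -> 0 < f x) ->
  (forall x, O x -> 0 <= g x) ->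
  poisson_solution O f g u -> poisson_solution O f g w ->
  forall x, closure O x -> u x = w x.
Proof.
move=> oO bO f0 g0 pu pw x clx; apply/eqP; rewrite eq_le.
by rewrite !(@poisson_solution_le R O f g).
Qed.

(** * Convexity and positive definite Hessians *)

(** A negative pure second derivative would make -u strictly midpoint convex at
    x along an axis. *)
Lemma convex_partial_ge0 (R : realType) (O : set (R * R)) u i x :
  open O -> smooth_closure O u -> strictly_convex_function O u -> O x ->
  0 <= partial i (partial i u) x.
Proof.
move=> oO su cu Ox; rewrite leNgt; apply/negP => neg.
have [su' _ _] := su.
(* -u, written u - 2 u to fit the closure under linear combinations. *)
have [sn _ _] := smooth_closure_lincomb (-2) oO su su.
have [|v [Opv Omv H]] := smooth_midpoint_strict_convex (i := i) oO sn Ox.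
  have := partials_lincomb (-2) [:: i; i] oO su' su' Ox; rewrite /= => ->; lra.
have v0 : x + v != x - v.
  apply: contraTneq H => E; rewrite -leNgt.
  have v0 : v = 0.
    have /eqP := E; rewrite eq_sym -subr_eq0 opprD addrACA subrr add0r -opprD oppr_eq0.
    by rewrite -mulr2n -scaler_nat scaler_eq0 pnatr_eq0 /= => /eqP.
  by rewrite v0 subr0 addr0; lra.
have := cu _ _ 2^-1 Opv Omv v0; rewrite invr_gt0 ltr0n invf_lt1 ?ltr0n //.
rewrite ltr1n => /(_ isT isT).
have -> : 2^-1 *: (x + v) + (1 - 2^-1) *: (x - v) = x.
  have -> : 1 - 2^-1 = 2^-1 :> R by lra.
  have -> : 2^-1 *: (x + v) + 2^-1 *: (x - v) = (2^-1 + 2^-1) *: x.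
    by rewrite -scalerDr addrACA subrr addr0 scalerDr scalerDl.
  have -> : 2^-1 + 2^-1 = 1 :> R by lra.
  by rewrite scale1r.
lra.
Qed.

(** The inequality between the arithmetic and geometric means for the eigenvalues
    of the Hessian, written with its entries:
    (a + d)^2 = (a - d)^2 + 4 b^2 + 4 (a d - b^2). *)
Lemma convex_laplacian_ge (R : realType) (O : set (R * R)) f u x :
  open O -> smooth_closure O u -> strictly_convex_function O u -> O x ->
  0 < f x -> \det (hessian u x) = f x -> 2 * Num.sqrt (f x) <= laplacian u x.
Proof.
move=> oO su cu Ox f0 dE; rewrite laplacianE.
have [su' _ _] := su.
have a0 := convex_partial_ge0 0 oO su cu Ox.
have d0 := convex_partial_ge0 1 oO su cu Ox.
move: dE; rewrite (det_hessian_smooth oO su' Ox).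
move: (partial 0 (partial 0 u) x) (partial 1 (partial 1 u) x) a0 d0 => a d a0 d0.
move: (partial _ _ _) => b dE.
rewrite -ler_sqr ?nnegrE ?addr_ge0 ?mulr_ge0 ?sqrtr_ge0 //.
rewrite exprMn sqr_sqrtr ?(ltW f0) // -dE.
have := sqr_ge0 (a - d); have := sqr_ge0 b; rewrite !expr2; lra.
Qed.

(** Completing the square, after multiplication by the positive entry a. *)
Lemma quadratic_form_gt0 (R : realFieldType) (a b d p q : R) :
  0 < a * d - b * b -> 0 < a + d -> (p != 0) || (q != 0) ->
  0 < a * p ^+ 2 + 2 * b * p * q + d * q ^+ 2.
Proof.
move=> det tr pq0; have b2 := sqr_ge0 b; rewrite expr2 in b2.
have a0 : 0 < a.
  rewrite ltNge; apply/negP => a0; have d0 : 0 < d by lra.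
  by have := mulr_le0_ge0 a0 (ltW d0); lra.
rewrite -(pmulr_rgt0 _ a0).
have -> : a * (a * p ^+ 2 + 2 * b * p * q + d * q ^+ 2) =
  (a * p + b * q) ^+ 2 + (a * d - b * b) * q ^+ 2 by ring.
have [q0|q0] := eqVneq q 0; last first.
  by rewrite ltr_wpDl ?sqr_ge0 // mulr_gt0 // lt_def sqr_ge0 expf_eq0 /= q0.
have p0 : p != 0 by move: pq0; rewrite q0 eqxx orbF.
rewrite q0 !mulr0 expr0n /= mulr0 !addr0.
by rewrite lt_def sqr_ge0 expf_eq0 /= mulf_neq0 // gt_eqF.
Qed.

Lemma convex_set_comb (R : realType) (V : lmodType R) (O : set V) x y (s : R) :
  convex_set O -> O x -> O y -> 0 <= s -> s <= 1 -> O (s *: x + (1 - s) *: y).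
Proof.
move=> cO Ox Oy s0 s1.
by have := cO x y (Itv01 s0 s1); rewrite !inE => /(_ Ox Oy).
Qed.

(** Along each segment of O the second derivative is the positive definite Hessian
    form at the nonzero direction of the segment. *)
Lemma posdef_strictly_convex (R : realType) (O : set (R * R)) u :
  open O -> convex_set O -> smooth_on O u ->
  (forall x, O x -> 0 < \det (hessian u x)) ->
  (forall x, O x -> 0 < laplacian u x) ->
  strictly_convex_function O u.
Proof.
move=> oO cO su det0 tr0 x y t Ox Oy xy t0 t1.
pose v : R * R := x - y.
have comb s : s *: x + (1 - s) *: y = y + s *: v.
  by rewrite /v scalerBr scalerBl scale1r addrCA.
have seg s : 0 <= s <= 1 -> O (y + s *: v).
  by move=> /andP[s0 s1]; rewrite -comb; exact: convex_set_comb.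
have v0 : v != 0 by rewrite subr_eq0.
have H s : 0 <= s <= 1 -> [/\ derivable u (y + s *: v) v,
    derivable ('D_v u) (y + s *: v) v & 0 < 'D_v ('D_v u) (y + s *: v)].
  move=> /seg Oz; have [d1 [d2 d2E]] := is_derive_second_direction v oO su Oz.
  split; [exact: d1|exact: d2|rewrite d2E].
  have := tr0 _ Oz; have := det0 _ Oz; rewrite laplacianE.
  rewrite (det_hessian_smooth oO su Oz).
  move: (partial 0 (partial 0 u) _) (partial 1 (partial 1 u) _) => a d.
  move: (partial _ _ _) => b ad tr.
  apply: quadratic_form_gt0 ad tr _; rewrite -negb_and.
  apply: contra v0 => /andP[/eqP v10 /eqP v20].
  by rewrite [v]surjective_pairing v10 v20.
have := strict_convex_segment t0 t1 H.
rewrite comb.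
have -> : y + 1 *: v = x by rewrite scale1r /v addrCA subrr addr0.
rewrite scale0r addr0 subr0; lra.
Qed.

Lemma strictly_convex_convex (R : realType) (O : set (R * R)) u :
  strictly_convex_function O u -> convex_function O u.
Proof.
move=> su t x y; rewrite !inE => Ox Oy.
have [->|xy] := eqVneq x y; first by rewrite !convmm.
have [->|t0] := eqVneq t 0%:i01; first by rewrite !conv0.
have [->|t1] := eqVneq t 1%:i01; first by rewrite !conv1.
apply: ltW; apply: su => //.
  by rewrite lt_neqAle eq_sym t0 ge0.
by rewrite lt_neqAle t1 le1.
Qed.

(** * The functional J *)

Section SimpleFunctions.
Import HBNNSimple.

(** The integral of a nonnegative function is a supremum over the simple functions
    below it, and c times the indicator of A is one of them. *)
Lemma ge_integral_const (d : measure_display) (T : measurableType d)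
    (R : realType) (mu : {measure set T -> \bar R}) (D A : set T)
    (F : T -> R) (c : R) :
  measurable A -> A `<=` D -> 0 <= c -> (forall x, D x -> 0 <= F x) ->
  (forall x, A x -> c <= F x) ->
  (c%:E * mu A <= \int[mu]_(x in D) (F x)%:E)%E.
Proof.
move=> mA AD c0 F0 cF; rewrite integral_mkcond ge0_integralTE; last first.
  by move=> x; rewrite erestrict_ge0 // => y Dy; rewrite lee_fin F0.
apply: ereal_sup_ubound; exists (scale_nnsfun (indic_nnsfun R mA) c0) => /=.
  move=> x; change ((c * \1_A x)%:E <= ((fun y => (F y)%:E) \_ D) x)%E.
  rewrite indicE; have [xA|xA] := boolP (x \in A); last first.
    by rewrite mulr0 erestrict_ge0 // => y Dy; rewrite lee_fin F0.
  have Ax : A x by exact: set_mem.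
  rewrite mulr1 patchE mem_set; last exact: AD.
  by rewrite lee_fin cF.
by rewrite [LHS](sintegralrM mu c (indic_nnsfun R mA)) sintegral_indic.
Qed.

End SimpleFunctions.

(** Around x there is a square of positive area on which F is at least F x / 2. *)
Lemma integral_gt0 (R : realType) (O : set (R * R)) (F : R * R -> R) x :
  open O -> O x -> (forall y, O y -> 0 <= F y) -> {for x, continuous F} ->
  0 < F x ->
  (0 < \int[@lebesgue_measure R \x @lebesgue_measure R]_(y in O) (F y)%:E)%E.
Proof.
move=> oO Ox F0 cF Fx0.
have nF : \forall y \near x, F x / 2 < F y.
  by move/cvgr_gt : cF; apply; rewrite ltr_pdivrMr // ltr_pMr // ltr1n.
have nO : \forall y \near x, O y by exact: open_nbhs_nbhs.
have [r /= r0 rP] : exists2 r : R, 0 < r & forall y, ball x r y ->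
    O y /\ F x / 2 < F y.
  have nOF : nbhs x (O `&` (fun y => F x / 2 < F y)) by exact: filterI nO nF.
  by move/nbhs_ballP : nOF => [r r0 rP]; exists r.
pose I a := `]a - r, a + r[%classic : set R.
have BI a y : I a y -> ball a r y.
  rewrite /I /= in_itv /= -ball_normE /= ltr_norml => /andP[h1 h2].
  by apply/andP; split; lra.
pose A := I x.1 `*` I x.2.
have AP y : A y -> O y /\ F x / 2 < F y.
  by move=> [y1 y2]; apply: rP; split; exact: BI.
have mI a : measurable (I a) by exact: measurable_itv.
have muI a : lebesgue_measure (I a) = (2 * r)%:E.
  rewrite /I lebesgue_measure_itv /= lte_fin ifT; last by lra.
  by rewrite -EFinD; congr (_%:E); lra.
have muA : ((@lebesgue_measure R \x @lebesgue_measure R) A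
    = (2 * r)%:E * (2 * r)%:E)%E.
  have E1 := product_measure1E (@lebesgue_measure R) (@lebesgue_measure R)
    (mI x.1) (mI x.2).
  have E2 := congr2 (fun a b : \bar R => (a * b)%E) (muI x.1) (muI x.2).
  exact: (etrans E1 E2).
have c0 : 0 <= F x / 2 by rewrite divr_ge0 // ltW.
have mA : measurable A by exact: measurableX.
have AO : A `<=` O by move=> y /AP[].
have cA y : A y -> F x / 2 <= F y by move=> /AP[_ /ltW].
have := @ge_integral_const _ _ R
  (@lebesgue_measure R \x @lebesgue_measure R)%E O A F (F x / 2) mA AO c0 F0 cA.
apply: lt_le_trans; rewrite [X in (_ * X)%E]muA -!EFinM lte_fin.
by rewrite !mulr_gt0 // invr_gt0.
Qed.

Lemma J_ge0 (R : realType) (O : set (R * R)) f g : (0 <= J O f g)%E.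
Proof.
rewrite /J mule_ge0 ?lee_fin ?invr_ge0 // integral_ge0 // => x _.
by rewrite lee_fin sqr_ge0.
Qed.

Lemma J_eq0_pointwise (R : realType) (O : set (R * R)) f g :
  open O -> J O f g = 0%E ->
  (forall x, O x -> {for x, continuous f}) ->
  smooth_on O (poisson_sol O f g) ->
  forall x, O x -> \det (hessian (poisson_sol O f g) x) = f x.
Proof.
move=> oO J0 cf su x Ox; set u := poisson_sol O f g in su *.
apply/eqP; rewrite -subr_eq0 -sqrf_eq0.
apply: contra_eqT J0 => n0.
rewrite gt_eqF // /J mule_gt0 // ?lte_fin ?invr_gt0 //.
apply: (integral_gt0 oO Ox) => [y _||]; first exact: sqr_ge0.
  have c s : {for x, continuous (partials s u)} by have [] := su s x Ox.
  have cdet : {for x, continuous (fun y => \det (hessian u y))}.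
    have -> : (fun y => \det (hessian u y)) = (fun y =>
      partials [:: 0; 0] u y * partials [:: 1; 1] u y -
      partials [:: 0; 1] u y * partials [:: 1; 0] u y).
      by apply/funext => y; exact: det_hessianE.
    apply: cvgB; apply: cvgM; exact: c.
  have cd : {for x, continuous (fun y => \det (hessian u y) - f y)}.
    by apply: cvgB; [exact: cdet|exact: cf].
  have -> : (fun y => (\det (hessian u y) - f y) ^+ 2) =
    (fun y => (\det (hessian u y) - f y) * (\det (hessian u y) - f y)).
    by apply/funext => y; rewrite expr2.
  by apply: cvgM; exact: cd.
by rewrite lt_def n0 sqr_ge0.
Qed.

(** * Minimizers and the Monge-Ampere equation *)

(** The source is Delta u - 2 sqrt f, extended continuously from O to its closure;
    it is nonnegative by [convex_laplacian_ge]. *)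
Lemma MA_poisson_source (R : realType) (O : set (R * R)) f u :
  open O -> smooth_closure O f -> (forall x, closure O x -> 0 < f x) ->
  strictly_convex_MA_solution O f u ->
  exists g, E_set O g /\ poisson_solution O f g u.
Proof.
move=> oO sf f0 [su [detu bu _] cu].
have kf k : Ck_closure O k f := smooth_closure_Ck sf [::] k.
have ku i k : Ck_closure O k (partial i (partial i u)) :=
  smooth_closure_Ck su [:: i; i] k.
have [_ cf _] := sf.
(* sqrt f is written f * f^(-1/2), the power whose smoothness is established. *)
pose w x : R := partial 0 (partial 0 u) x + partial 1 (partial 1 u) x
     + (-2) * (f x * (Num.sqrt (f x))^-1).
have kw k : Ck_closure O k w.
  apply: Ck_closureD => //; first exact: Ck_closureD.
  apply: Ck_closureM => //; first exact: (Ck_closure_cst O k (-2)).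
  apply: Ck_closureM => //; exact: Ck_closure_rsqrt.
have [g [sg gw]] := Ck_closure_extension oO kw.
have gE x : O x -> g x = laplacian u x - 2 * Num.sqrt (f x).
  move=> Ox; rewrite gw // /w -laplacianE mulNr; congr (_ - 2 * _).
  have fx0 : 0 < f x by apply: f0; exact: subset_closure.
  rewrite -{1}[f x]sqr_sqrtr ?(ltW fx0) // expr2 mulfK // gt_eqF //.
  by rewrite sqrtr_gt0.
exists g; split.
  split=> //; apply: closure_ge0; first by have [] := sg.
  move=> x Ox; rewrite gE // subr_ge0.
  by apply: (convex_laplacian_ge oO su cu Ox _ (detu x Ox));
    apply: f0; exact: subset_closure.
by split=> // x Ox; rewrite gE // addrC subrK.
Qed.

Lemma poisson_solP (R : realType) (O : set (R * R)) f g u :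
  poisson_solution O f g u -> poisson_solution O f g (poisson_sol O f g).
Proof. by move=> pu; apply: xgetPex; exists u. Qed.

Lemma poisson_sol_eq (R : realType) (O : set (R * R)) f g u :
  open O -> bounded_set O -> (forall x, closure O x -> 0 < f x) ->
  E_set O g -> poisson_solution O f g u ->
  forall x, closure O x -> u x = poisson_sol O f g x.
Proof.
move=> oO bO f0 [_ g0] pu; apply: (poisson_solution_unique oO bO _ _ pu).
- by move=> x /subset_closure/f0.
- by move=> x /subset_closure/g0.
- exact: poisson_solP pu.
Qed.

Lemma J_eq0_poisson_source (R : realType) (O : set (R * R)) f g u :
  open O -> bounded_set O -> (forall x, closure O x -> 0 < f x) ->
  E_set O g -> poisson_solution O f g u ->
  (forall x, O x -> \det (hessian u x) = f x) -> J O f g = 0%E.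
Proof.
move=> oO bO f0 Eg pu detu; rewrite /J integral0_eq ?mule0 // => x Ox.
rewrite -(eq_hessian oO _ Ox (u := u)) ?detu ?subrr ?expr0n // => y Oy.
by rewrite (poisson_sol_eq oO bO f0 Eg pu) //; exact: subset_closure.
Qed.

(** The determinant of the Hessian is f > 0 and its trace is 2 sqrt f + g > 0, so
    the Hessian is positive definite.  The existence of u^g comes for free: without
    it the default value, the zero function, would force f to vanish. *)
Lemma J_eq0_MA_solution (R : realType) (O : set (R * R)) f g :
  O !=set0 -> open O -> convex_set O -> smooth_closure O f ->
  (forall x, closure O x -> 0 < f x) -> E_set O g -> J O f g = 0%E ->
  poisson_solution O f g (poisson_sol O f g) /\
  strictly_convex_MA_solution O f (poisson_sol O f g).
Proof.
move=> [x0 Ox0] oO cO [sf _ _] f0 [_ g0] J0.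
have cf x : O x -> {for x, continuous f}.
  by move=> Ox; have [c _] := sf [::] x Ox; exact: c.
have pu : poisson_solution O f g (poisson_sol O f g).
  have [[u pu]|nopu] := pselect (exists u, poisson_solution O f g u).
    exact: poisson_solP pu.
  have u0 : poisson_sol O f g = cst 0.
    by apply: xgetPN => u pu; apply: nopu; exists u.
  have su : smooth_on O (poisson_sol O f g).
    by rewrite u0; have [] := smooth_closure_cst 0 oO.
  have := J_eq0_pointwise oO J0 cf su Ox0.
  rewrite u0 det_hessian_cst => f00.
  by have := f0 x0 (subset_closure Ox0); rewrite -f00 ltxx.
have [su Lu bu] := pu; have [su' _ _] := su.
have detu := J_eq0_pointwise oO J0 cf su'.
have cu : strictly_convex_function O (poisson_sol O f g).
  apply: (posdef_strictly_convex oO cO su') => x Ox.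
    by rewrite detu // f0 //; exact: subset_closure.
  rewrite Lu // ltr_wpDr ?g0 ?mulr_gt0 ?sqrtr_gt0 ?f0 //; exact: subset_closure.
split=> //; split=> //; split=> //; exact: strictly_convex_convex.
Qed.

Lemma eq_strictly_convex_MA_solution (R : realType) (O : set (R * R)) f u v :
  open O -> convex_set O -> smooth_closure O v ->
  (forall x, closure O x -> v x = u x) ->
  strictly_convex_MA_solution O f u -> strictly_convex_MA_solution O f v.
Proof.
move=> oO cO sv vu [_ [detu bu cu] scu].
have vuO x : O x -> v x = u x by move=> /subset_closure; exact: vu.
have scv : strictly_convex_function O v.
  move=> x y t Ox Oy xy t0 t1.
  rewrite !vuO //; first exact: scu.
  by apply: convex_set_comb => //; exact: ltW.
split; [exact: sv|split|exact: scv]; last exact: strictly_convex_convex.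
  by move=> x Ox; rewrite (eq_hessian oO vuO Ox) detu.
by move=> x bx; rewrite vu ?bu //; case: bx.
Qed.

Theorem theorem1 (R : realType) (Omega : set (R * R)) (f : R * R -> R)
  (hOmega : smooth_convex_bounded_domain Omega)
  (hf : smooth_closure Omega f)
  (hf_pos : forall x, closure Omega x -> 0 < f x)
  (hMA_exists : exists u, strictly_convex_MA_solution Omega f u)
  (hMA_unique : forall u v, strictly_convex_MA_solution Omega f u ->
     strictly_convex_MA_solution Omega f v ->
     forall x, closure Omega x -> u x = v x)
  (uI : R * R -> R) (huI : smooth_closure Omega uI) :
  strictly_convex_MA_solution Omega f uI <->
  exists g : R * R -> R,
    [/\ J_minimizer Omega f g,
        forall h, J_minimizer Omega f h ->
          forall x, closure Omega x -> h x = g x &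
        forall x, closure Omega x -> uI x = poisson_sol Omega f g x].
Proof.
have [neO oO cO bO _] := hOmega.
have J0_of u : strictly_convex_MA_solution Omega f u -> exists g,
    [/\ E_set Omega g, poisson_solution Omega f g u & J Omega f g = 0%E].
  move=> mu; have [g [Eg pu]] := MA_poisson_source oO hf hf_pos mu.
  exists g; split=> //; apply: (J_eq0_poisson_source oO bO hf_pos Eg pu).
  by have [_ [detu _ _] _] := mu.
have min_J0 g : J_minimizer Omega f g -> J Omega f g = 0%E.
  move=> [_ gmin]; have [u /J0_of[h [Eh _ Jh]]] := hMA_exists.
  by apply/eqP; rewrite eq_le J_ge0 andbT -Jh gmin.
have min_MA g : J_minimizer Omega f g ->
    poisson_solution Omega f g (poisson_sol Omega f g) /\
    strictly_convex_MA_solution Omega f (poisson_sol Omega f g).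
  move=> gmin; have Jg := min_J0 g gmin; have [Eg _] := gmin.
  exact: J_eq0_MA_solution.
split=> [muI|[g [gmin _ uIg]]]; last first.
  exact: (eq_strictly_convex_MA_solution oO cO huI uIg (min_MA g gmin).2).
have [g [Eg pg Jg]] := J0_of uI muI.
have gmin : J_minimizer Omega f g.
  by split=> [|h _]; [exact: Eg|rewrite Jg; exact: J_ge0].
exists g; split; [exact: gmin| |exact: (poisson_sol_eq oO bO hf_pos Eg pg)].
move=> h hmin; have [ph mh] := min_MA h hmin.
have uIh := hMA_unique _ _ muI mh.
have [[[_ ch _] _] _] := hmin; have [[_ cg _] _] := Eg.
apply: (eq_closure ch cg) => x Ox.
have [_ Lg _] := pg; have [_ Lh _] := ph.
have eL : laplacian uI x = laplacian (poisson_sol Omega f h) x.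
  rewrite /laplacian (eq_hessian oO _ Ox (v := poisson_sol Omega f h)) //.
  by move=> y /subset_closure; exact: uIh.
apply/esym/(@addrI _ (2 * Num.sqrt (f x))).
by rewrite -(Lg x Ox) -(Lh x Ox); exact: eL.
Qed.
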